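(* Let $\mathcal{C}$ be a temporal cycle with $n$ vertices, with lifetime $L\geq 2n-2$ and a starting vertex $s$. Then there is an exploration of $\mathcal{C}$ starting from $s$ and traversing at most $\lfloor \frac{3}{2}(n-1)\rfloor$ edges.
   Context: A temporal graph $\mathcal{G}$ with (finite) vertex set $V$, $|V|=n$, and lifetime $L$ is a sequence $(G_1,\dots,G_L)$ of static undirected graphs $G_i=(V,E_i)$; $G_i$ is the snapshot at time step $i$. All temporal graphs are assumed constantly connected: every $G_i$ is connected. The underlying graph is $(V,\bigcup_i E_i)$. A temporal cycle is a (constantly connected) temporal graph whose underlying graph is a cycle on the $n\ge 3$ vertices (so each snapshot misses at most one edge of the cycle). A (strict) journey from $u$ to $v$ is a sequence $((v_0,v_1),t_1),\dots,((v_{l-1},v_l),t_l)$ with $v_0=u$, $v_l=v$, $1\le t_1<t_2<\dots<t_l\le L$ (not necessarily consecutive) and $\{v_{i-1},v_i\}\in E_{t_i}$ for all $i$. The number of edges traversed is $l$, counted with multiplicity. The journey visits the vertices $v_0,\dots,v_l$. An exploration starting at $s$ is a strict journey with $v_0=s$ that visits all vertices of $V$. *)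

(* Defs.v *)
From mathcomp Require Import all_boot.

Set Implicit Arguments.
Unset Strict Implicit.
Unset Printing Implicit Defensive.

Record sgraph (V : finType) := SGraph {
  adj :> rel V;
  adj_sym : symmetric adj;
  adj_irrefl : irreflexive adj
}.

Definition connected_graph (V : finType) (g : sgraph V) : Prop :=
  forall u v : V, connect g u v.

(* As [c] is duplicate-free, [next c u] is the vertex following [u] in the
   cyclic order [c]. *)
Definition is_cycle_graph (V : finType) (g : sgraph V) : Prop :=
  3 <= #|V| /\
  exists c : seq V,
    [/\ uniq c,
        (forall v : V, v \in c)
      & forall u v : V, g u v = (v == next c u) || (u == next c v)].

(* Time steps are numbered from 0: [G i] is the snapshot at time step i + 1. *)
Definition tgraph (V : finType) (L : nat) := 'I_L -> sgraph V.

Definition constantly_connected (V : finType) (L : nat) (G : tgraph V L) :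
    Prop :=
  forall i : 'I_L, connected_graph (G i).

Definition underlying_adj (V : finType) (L : nat) (G : tgraph V L) : rel V :=
  fun u v => [exists i : 'I_L, G i u v].

Lemma underlying_sym (V : finType) (L : nat) (G : tgraph V L) :
  symmetric (underlying_adj G).
Proof. by move=> u v; apply: eq_existsb => i; rewrite adj_sym. Qed.

Lemma underlying_irrefl (V : finType) (L : nat) (G : tgraph V L) :
  irreflexive (underlying_adj G).
Proof. by move=> u; apply/existsP => -[i]; rewrite adj_irrefl. Qed.

Definition underlying (V : finType) (L : nat) (G : tgraph V L) : sgraph V :=
  SGraph (underlying_sym G) (underlying_irrefl G).

Definition temporal_cycle (V : finType) (L : nat) (G : tgraph V L) : Prop :=
  constantly_connected G /\ is_cycle_graph (underlying G).

(* [((x, y), t)] is the traversal of the edge {x, y} from x to y at time t. *)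
Definition tstep (V : finType) (L : nat) : Type := (V * V * 'I_L)%type.

Fixpoint temporal_walk (V : finType) (L : nat) (G : tgraph V L) (u : V)
    (j : seq (tstep V L)) : bool :=
  if j is ((x, y), t) :: j' then [&& x == u, G t x y & temporal_walk G y j']
  else true.

(* The empty journey is allowed, from a vertex to itself. *)
Definition journey (V : finType) (L : nat) (G : tgraph V L) (u v : V)
    (j : seq (tstep V L)) : bool :=
  [&& temporal_walk G u j,
      last u [seq e.1.2 | e <- j] == v
    & sorted ltn [seq nat_of_ord e.2 | e <- j]].

Definition visited (V : finType) (L : nat) (u : V) (j : seq (tstep V L)) :
    seq V :=
  u :: [seq e.1.2 | e <- j].

Definition exploration (V : finType) (L : nat) (G : tgraph V L) (s : V)
    (j : seq (tstep V L)) : Prop :=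
  (exists v : V, journey G s v j) /\ (forall w : V, w \in visited s j).

(* Main.v *)
Require Import Defs.
From mathcomp Require Import all_boot.
From mathcomp Require Import zify.

(** Put N = n - 1 and let every walker be greedy.  One walker, [cw], goes
    clockwise from s; for each a, another one follows it to its a-th vertex and
    then turns back for good ([ccw a]).  The latter has seen everything after N
    counterclockwise moves, that is, after a + N moves, so we want such a walker
    with 2a <= N to succeed by time 2N, possibly after reflecting the cycle.

    Until they face each other across one edge, [cw] and [ccw 0] are never
    blocked simultaneously, so by some time t0 <= N they have made N moves
    together, and up to reflection [cw] has made at least c moves and [ccw 0] at
    least N - c, for some c <= N / 2.  Suppose that no walker turning back at
    a <= c succeeds.  If walker k < c has been merged with walker 0, the latter
    makes at most N - 1 - k moves by time 2N.  Were walker k + 1, leaving at tau,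
    never merged with walker 0, then at each time walker 0 or [cw] (before tau)
    or walker k + 1 (after tau) would move, giving at most
    (N - 1 - k) + (k + 1) + (N - 1) < 2N moves in 2N steps.  So by induction
    walker c merges with walker 0; but then walker c has succeeded. *)

Set Implicit Arguments.
Unset Strict Implicit.
Unset Printing Implicit Defensive.

(** * Greedy walkers, counted by moves *)

Section Greedy.
Implicit Types (q : nat -> nat -> bool) (t p : nat).

(** The number of moves determines the position, so it is the only state kept; [q t p] tells whether
    the edge met after [p] moves is present at time [t]. *)
Fixpoint moves q t0 t :=
  if t is t'.+1 then moves q t0 t' + ((t0 <= t') && q t' (moves q t0 t'))
  else 0.

Lemma moves_before q t0 t : t <= t0 -> moves q t0 t = 0.
Proof.
elim: t => //= t IH lt_t; rewrite IH ?(ltnW lt_t) //.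
by rewrite leqNgt lt_t.
Qed.

Lemma leq_moves q t0 t t' : t <= t' -> moves q t0 t <= moves q t0 t'.
Proof.
elim: t' => [|t' IH]; first by rewrite leqn0 => /eqP->.
by rewrite leq_eqVlt => /predU1P[->//|/IH] /leq_trans-> //=; rewrite leq_addr.
Qed.

Lemma moves_attained q t0 t m :
  m <= moves q t0 t -> exists2 t', t' <= t & moves q t0 t' = m.
Proof.
elim: t => [|t IH] /= le_m; first by exists 0 => //=; lia.
case: (leqP m (moves q t0 t)) => [/IH[t' le_t' <-]|lt_m].
  by exists t' => //; lia.
by exists t.+1 => //=; lia.
Qed.

Lemma eq_moves q q' t0 T :
    (forall t, t < T -> q t (moves q t0 t) = q' t (moves q t0 t)) ->
  forall t, t <= T -> moves q t0 t = moves q' t0 t.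
Proof.
by move=> eq_q; elim=> //= t IH lt_t; rewrite -IH ?(ltnW lt_t) // eq_q.
Qed.

End Greedy.

(** * Clockwise and counterclockwise walkers on the ring *)

Section Ring.
Variable N : nat.
Implicit Types (pres : nat -> nat -> bool) (t i a k tau : nat).

Definition cw pres := moves pres 0.

(* The [p]-th counterclockwise edge from vertex [a] has index [a - 1 - p],
   where edge [i] joins vertices [i] and [i + 1] modulo [N + 1]. *)
Definition ccw pres a := moves (fun t p => pres t ((a + N - p) %% N.+1)).

Lemma ccwS pres a tau t : ccw pres a tau t.+1 =
  ccw pres a tau t +
    ((tau <= t) && pres t ((a + N - ccw pres a tau t) %% N.+1)).
Proof. by []. Qed.

(** The reflection fixing vertex 0 sends vertex [i] to [N + 1 - i], hence edge [i] to edge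
    [N - i]. *)
Definition mirror pres t i := pres t (N - i).

Definition one_missing pres := forall t i j, t < 2 * N -> i <= N -> j <= N ->
  ~~ pres t i -> ~~ pres t j -> i = j.

Definition cheap_tour pres := exists tau,
  [/\ tau <= 2 * N, 2 * cw pres tau <= N
    & N <= ccw pres (cw pres tau) tau (2 * N)].

Lemma one_missing_mirror pres : one_missing pres -> one_missing (mirror pres).
Proof.
move=> one t i j lt_t le_i le_j ni nj.
by have := one t _ _ lt_t (leq_subr i N) (leq_subr j N) ni nj; lia.
Qed.

(** Equality of the counts puts both walkers on the same vertex, so they face the same edges ever
    after. *)
Lemma ccw_merged pres a tau t t' :
    tau <= t -> t <= t' -> a + ccw pres 0 0 t = ccw pres a tau t ->
  a + ccw pres 0 0 t' = ccw pres a tau t'.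
Proof.
move=> le_tau; elim: t' => [|t' IH]; first by rewrite leqn0 => /eqP<-.
rewrite leq_eqVlt => /predU1P[<-//|lt_t] /(IH lt_t) eq_t'.
rewrite !ccwS -eq_t' (leq_trans le_tau lt_t) /=.
by rewrite add0n subnDl addnA.
Qed.

Lemma modn_inj_small n i j : i < n + j -> j < n + i ->
  i = j %[mod n] -> i = j.
Proof.
wlog le_ij : i j / i <= j => [W|] lt_i lt_j eq_ij.
  by case: (leqP i j) => [|/ltnW] le_ij; [|symmetry]; apply: W.
have /eqP := eq_ij; rewrite eq_sym eqn_mod_dvd // => /dvdnP[[|q]]; nia.
Qed.

(** With fewer than [N] moves in total, the two walkers face different edges, and at most one of
    these is missing. *)
Lemma leq_cw_ccw pres t : one_missing pres -> t <= 2 * N ->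
    (forall t', t' < t -> cw pres t' + ccw pres 0 0 t' < N) ->
  t <= cw pres t + ccw pres 0 0 t.
Proof.
move=> one; elim: t => // t IH lt_t lt_sum.
have {IH} := IH (ltnW lt_t) (fun t' lt' => lt_sum t' (ltnW lt')).
have := lt_sum t (ltnSn t).
rewrite ccwS /cw /= -!/(cw _ _) add0n modn_small ?ltnS ?leq_subr //.
set b := cw _ _; set a := ccw _ _ _ _ => lt_ba.
case: (boolP (pres t b)) => nb; case: (boolP (pres t _)) => na; try lia.
by have := one t b _ lt_t _ _ nb na; lia.
Qed.

(** Unmerged walkers stand on different vertices, so one of them moves at each step. As counts only
    grow, the bounds at time [2 * N] hold throughout and keep the edge indices from coinciding
    modulo [N.+1]. *)
Lemma leq_ccw_ccw pres a tau t : one_missing pres -> tau <= t -> t <= 2 * N ->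
    a + ccw pres 0 0 (2 * N) != ccw pres a tau (2 * N) ->
    a + ccw pres 0 0 (2 * N) <= N -> ccw pres a tau (2 * N) < N ->
  t - tau + ccw pres 0 0 tau <= ccw pres 0 0 t + ccw pres a tau t.
Proof.
move=> one + + neq le0 lea; elim: t => [|t IH].
  by rewrite leqn0 => /eqP-> _; rewrite subnn leq_addr.
rewrite leq_eqVlt => /predU1P[<- _|].
  by rewrite subnn leq_addr.
rewrite ltnS => le_tau lt_t.
have {IH} := IH le_tau (ltnW lt_t).
have neq_t : a + ccw pres 0 0 t != ccw pres a tau t.
  apply: contraNneq neq => eq_t; apply/eqP.
  exact: ccw_merged le_tau (ltnW lt_t) eq_t.
have le0t : ccw pres 0 0 t <= ccw pres 0 0 (2 * N).
  exact/leq_moves/ltnW.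
have leat : ccw pres a tau t <= ccw pres a tau (2 * N).
  exact/leq_moves/ltnW.
rewrite !ccwS le_tau /= add0n.
move: neq_t le0t leat; set b := ccw _ 0 _ _; set p := ccw _ _ _ t.
move=> neq_t le0t leat.
case: (boolP (pres t _)) => nb; case: (boolP (pres t _)) => na; try lia.
have := one t _ _ lt_t (ltn_pmod _ (ltn0Sn N)) (ltn_pmod _ (ltn0Sn N)) nb na.
by move/modn_inj_small; lia.
Qed.

Lemma cheap_tour_from_split pres c t0 : one_missing pres ->
    t0 <= 2 * N -> 2 * c <= N -> c <= cw pres t0 ->
    (forall t, t < t0 -> cw pres t + ccw pres 0 0 t < N) ->
    N <= c + ccw pres 0 0 (2 * N) ->
    (forall tau, tau <= 2 * N -> 2 * cw pres tau <= N ->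
       ccw pres (cw pres tau) tau (2 * N) < N) ->
  False.
Proof.
move=> one le_t0 le_c le_cw lt_sum le_N fail.
have merged k : k <= c -> exists tau, [/\ tau <= t0, cw pres tau = k
    & k + ccw pres 0 0 (2 * N) = ccw pres k tau (2 * N)].
  elim: k => [|k IH] lt_k; first by exists 0.
  have [tau' [le' cw' eq']] := IH (ltnW lt_k).
  (* Failure of walker [k], read on walker 0 through the merger, yields the bound
     [k.+1 + ccw pres 0 0 (2 * N) <= N] required by [leq_ccw_ccw]. *)
  have := fail tau'; rewrite cw' -eq' => failk.
  have [tau le_tau eq_cw] := moves_attained (leq_trans lt_k le_cw).
  rewrite -/(cw _ _) in eq_cw.
  exists tau; split=> //; apply/eqP; apply/negPn/negP => neq.
  have := fail tau; rewrite eq_cw => failS.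
  have le2 : tau <= 2 * N by lia.
  (* Adding the move counts before and after [tau], walker 0's moves before [tau] cancel. *)
  have := leq_ccw_ccw one le2 (leqnn _) neq.
  have := leq_cw_ccw one le2.
  rewrite eq_cw => /(_ (fun t lt_t => lt_sum t (leq_trans lt_t le_tau))).
  lia.
have [tau [le_tau eq_cw eq_c]] := merged c (leqnn c).
by have := fail tau; rewrite eq_cw -eq_c; lia.
Qed.

Lemma cheap_tourPn pres : cheap_tour pres \/
  (forall tau, tau <= 2 * N -> 2 * cw pres tau <= N ->
     ccw pres (cw pres tau) tau (2 * N) < N).
Proof.
case: (boolP [exists tau : 'I_(2 * N).+1, (2 * cw pres tau <= N) &&
    (N <= ccw pres (cw pres tau) tau (2 * N))]).
  by case/existsP=> tau /andP[? ?]; left; exists tau; rewrite -ltnS.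
rewrite negb_exists => /forallP none; right=> tau le_tau le_cw.
have := none (inord tau); rewrite inordK // le_cw /=; lia.
Qed.

Lemma cheap_tour_or_mirror pres : one_missing pres ->
  cheap_tour pres \/ cheap_tour (mirror pres).
Proof.
move=> one; case: (cheap_tourPn pres) => [|fail]; first by left.
case: (cheap_tourPn (mirror pres)) => [|fail']; first by right.
have [le02 cw0] : 0 <= 2 * N /\ 2 * 0 <= N by [].
(* This keeps the count within [N], so that [N - (N - p) = p] in [ccwM]. *)
have lt_ccw' := fail' 0 le02 cw0; rewrite [cw _ 0]/= in lt_ccw'.
have cwM t : cw (mirror pres) t = ccw pres 0 0 t.
  apply: (@eq_moves _ _ _ t) => // t' _.
  by rewrite /mirror add0n modn_small // ltnS leq_subr.
have ccwM t : t <= 2 * N -> ccw (mirror pres) 0 0 t = cw pres t.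
  apply: eq_moves => t' lt_t'; rewrite /mirror.
  rewrite add0n modn_small ?ltnS ?leq_subr // subKn //.
  apply: leq_trans (ltnW lt_ccw'); exact/leq_moves/ltnW.
have : exists t, N <= cw pres t + ccw pres 0 0 t.
  case: (boolP [exists t : 'I_N.+1, N <= cw pres t + ccw pres 0 0 t]).
    by case/existsP=> t; exists t.
  rewrite negb_exists => /forallP none; exists N; apply: leq_cw_ccw => //.
    lia.
  move=> t lt_t; have := none (inord t); rewrite inordK; lia.
move/ex_minnP=> [t0 le_sum min_t0].
have lt_sum t : t < t0 -> cw pres t + ccw pres 0 0 t < N.
  by move=> lt_t; rewrite ltnNge; apply/negP => /min_t0; lia.
have le_t0 : t0 <= N.
  rewrite leqNgt; apply/negP => lt_t0.
  have : N <= cw pres N + ccw pres 0 0 N.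
    by apply: leq_cw_ccw => // [|t lt_t]; [|apply: lt_sum]; lia.
  by have := lt_sum N lt_t0; lia.
exfalso.
have le_t2 : t0 <= 2 * N by lia.
case: (leqP (cw pres t0) (ccw pres 0 0 t0)) => le_ab.
  (* Both walkers may move in the last step, making the total [N.+1]; for odd [N] even the smaller
     count can then exceed [N./2], hence the cap. *)
  apply: (@cheap_tour_from_split pres (minn (cw pres t0) N./2) t0) => //.
  - lia.
  - lia.
  - have := leq_moves (fun t p => pres t ((0 + N - p) %% N.+1)) 0 le_t2.
    rewrite -!/(ccw _ _ _ _); lia.
apply: (@cheap_tour_from_split (mirror pres) (minn (ccw pres 0 0 t0) N./2) t0).
- exact: one_missing_mirror.
- by [].
- lia.
- rewrite cwM; lia.
- by move=> t lt_t; rewrite cwM ccwM; have := lt_sum t lt_t; lia.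
- rewrite ccwM //; have := leq_moves pres 0 le_t2.
  rewrite -!/(cw _ _); lia.
- exact: fail'.
Qed.

End Ring.

(** * From greedy walkers to strict journeys *)

Section Travel.
Variables (V : finType) (L : nat) (G : tgraph V L).

Definition at_time t : rel V :=
  fun u v => if insub t is Some i then G i u v else false.

(** Half-open time windows make concatenated journeys strict. *)
Definition travel t0 t1 u (r : seq V) := exists j : seq (tstep V L),
  [/\ temporal_walk G u j, [seq e.1.2 | e <- j] = r,
      sorted ltn [seq nat_of_ord e.2 | e <- j]
    & all (fun e : tstep V L => t0 <= e.2 < t1) j].

Lemma temporal_walk_cat u j j' : temporal_walk G u (j ++ j') =
  temporal_walk G u j && temporal_walk G (last u [seq e.1.2 | e <- j]) j'.
Proof. by elim: j u => //= -[[x y] t] j IH u; rewrite IH !andbA. Qed.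

Lemma travel_nil t0 t1 u : travel t0 t1 u [::].
Proof. by exists [::]. Qed.

Lemma travel1 t u v : at_time t u v -> travel t t.+1 u [:: v].
Proof.
rewrite /at_time; case: insubP => // i _ <- Guv.
by exists [:: ((u, v), i)]; rewrite /= eqxx Guv leqnn ltnSn.
Qed.

Lemma travel_cat t0 t1 t2 u r r' : t0 <= t1 -> t1 <= t2 ->
  travel t0 t1 u r -> travel t1 t2 (last u r) r' -> travel t0 t2 u (r ++ r').
Proof.
move=> le01 le12 [j [wj <- sj aj]] [j' [wj' <- sj' aj']].
exists (j ++ j'); split.
- by rewrite temporal_walk_cat wj.
- by rewrite map_cat.
- rewrite map_cat (sorted_pairwise ltn_trans) pairwise_cat.
  rewrite -!(sorted_pairwise ltn_trans) sj sj' !andbT.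
  apply/allrelP => x y /mapP[e /(allP aj)/andP[_ lt1] ->].
  by case/mapP=> e' /(allP aj')/andP[le1 _] ->; apply: leq_trans le1.
- rewrite all_cat; apply/andP; split.
    by apply: (sub_all _ aj) => e /andP[-> lt1]; apply: leq_trans le12.
  by apply: (sub_all _ aj') => e /andP[le1 ->]; rewrite (leq_trans le01 le1).
Qed.

Lemma travel_moves (q : nat -> nat -> bool) t0 t1 m (f : nat -> V) : t0 <= t1 ->
    (forall t p, p < m -> q t p -> at_time t (f p) (f p.+1)) ->
  moves q t0 t1 <= m ->
  travel t0 t1 (f 0) (mkseq (fun p => f p.+1) (moves q t0 t1)).
Proof.
move=> + step; elim: t1 => [|t1 IH] le_t1 le_m; first exact: travel_nil.
move: le_t1; rewrite leq_eqVlt => /predU1P[<-|].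
  by rewrite moves_before //; apply: travel_nil.
rewrite ltnS => le_t1.
have {}IH := IH le_t1 (leq_trans (leq_moves q t0 (leqnSn t1)) le_m).
case: (boolP (q t1 (moves q t0 t1))) => [q1|nq1] /=; last first.
  rewrite (negbTE nq1) andbF addn0 -[mkseq _ _]cats0.
  exact: travel_cat IH (travel_nil _ _ _).
move: le_m; rewrite /= le_t1 q1 addn1 mkseqS -cats1 => lt_m.
apply: travel_cat IH _ => //.
have -> : last (f 0) (mkseq (fun p => f p.+1) (moves q t0 t1)) =
          f (moves q t0 t1).
  by case: (moves q t0 t1) => // p; rewrite mkseqS last_rcons.
exact/travel1/step.
Qed.

Lemma exploration_of_cheap_tour N (v : nat -> V) (pres : nat -> nat -> bool) :
    0 < N ->
    (forall t i, i <= N -> pres t i ->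
       at_time t (v i) (v (i.+1 %% N.+1))) ->
    (forall w, exists2 i, i <= N & v i = w) ->
    cheap_tour N pres ->
  exists j, exploration G (v 0) j /\ size j <= (3 * N) %/ 2.
Proof.
move=> N_gt0 step surj [tau [_ le_cw le_ccw]].
(* Stopping after exactly [N] moves back gives length [a + N], where [2 * a <= N]. *)
have [T _] := moves_attained le_ccw; rewrite -/(ccw _ _ _ _ _).
set a := cw pres tau in le_cw le_ccw *; move=> eq_T.
have sym t x y : at_time t x y = at_time t y x.
  by rewrite /at_time; case: insub => // i; apply: adj_sym.
have le_tau : tau <= T.
  rewrite leqNgt; apply/negP => /ltnW lt_T.
  by move: eq_T; rewrite /ccw moves_before //; lia.
have go : travel 0 tau (v 0) (mkseq (fun p => v p.+1) a).
  apply: (@travel_moves pres _ _ a) => // t p lt_p pr.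
  have le_p : p <= N by lia.
  by have := step _ _ le_p pr; rewrite modn_small //; lia.
(* The summand [N.+1] prevents truncation of the subtraction for [p <= N]. *)
set f := fun p => v ((a + N.+1 - p) %% N.+1).
have back : travel tau T (f 0) (mkseq (fun p => f p.+1) N).
  rewrite -eq_T; apply: (@travel_moves _ _ _ N) => //; last first.
    exact: (eq_leq eq_T).
  move=> t p lt_p /step; rewrite -ltnS ltn_pmod // => /(_ isT).
  rewrite sym -addn1 modnDml addn1 /f.
  by rewrite addnS subSS subSn //; lia.
have f0 : f 0 = last (v 0) (mkseq (fun p => v p.+1) a).
  have -> : f 0 = v a by rewrite /f subn0 modnDr modn_small //; lia.
  by case: (a) => // p; rewrite mkseqS last_rcons.
rewrite f0 in back; have := travel_cat (leq0n _) le_tau go back.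
case=> j [wj rj sj _]; exists j; split; last first.
  rewrite -(size_map (fun e => e.1.2)) rj size_cat !size_mkseq.
  by rewrite leq_divRL //; lia.
split.
  exists (last (v 0) [seq e.1.2 | e <- j]).
  by rewrite /journey wj sj eqxx.
move=> w; have [i le_i <-] := surj w.
have [p le_p eq_p] : exists2 p, p <= N & (a + N.+1 - p) %% N.+1 = i.
  case: (leqP i a) => [le_ia|lt_ai].
    exists (a - i); first lia.
    have -> : a + N.+1 - (a - i) = i + N.+1 by lia.
    by rewrite modnDr modn_small.
  exists (a + N.+1 - i); first lia.
  by rewrite subKn ?modn_small //; lia.
(* For [p = 0] this is the turning vertex, already reached on the outward leg. *)
rewrite /visited rj -eq_p -/(f p); case: p le_p {eq_p} => [|p] lt_p.
  by rewrite f0 -cat_cons mem_cat mem_last.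
rewrite inE mem_cat; apply/orP; right; apply/orP; right.
by apply/mapP; exists p; rewrite // mem_iota.
Qed.

(** Were edges [i < j] both missing, the arc [i + 1, ..., j] would be closed under adjacency, yet it
    contains [v j] and not [v i]. *)
Lemma one_missing_cycle N (v : nat -> V) : 2 * N <= L ->
    constantly_connected G ->
    (forall i j, i <= N -> j <= N -> v i = v j -> i = j) ->
    (forall t x y, G t x y -> exists2 i, i <= N &
       x = v i /\ y = v (i.+1 %% N.+1) \/ y = v i /\ x = v (i.+1 %% N.+1)) ->
  one_missing N (fun t i => at_time t (v i) (v (i.+1 %% N.+1))).
Proof.
move=> le_L conn inj cyc t i j lt_t.
wlog lt_ij : i j / i < j => [W|] le_i le_j.
  by case: (ltngtP i j) => // lt_ij ni nj; [|symmetry]; apply: W.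
rewrite /at_time insubT ?(leq_trans lt_t) // => lt_tL; set k := Sub t _.
move=> ni nj; exfalso.
pose S := [pred x | [exists p : 'I_N.+1, (i < p <= j) && (v p == x)]].
have inS p : p <= N -> (v p \in S) = (i < p <= j).
  rewrite -ltnS => lt_p.
  apply/existsP/idP => [[p' /andP[le_p' /eqP eq_v]]|le_p].
    by rewrite -(inj _ _ (ltn_ord p') lt_p eq_v).
  by exists (Ordinal lt_p); rewrite /= le_p eqxx.
have arc p : p <= N -> p <> i -> p <> j ->
    (v p \in S) = (v (p.+1 %% N.+1) \in S).
  move=> le_p ne_i ne_j; rewrite !inS //; last by rewrite -ltnS ltn_pmod.
  (* The closing edge joins [v N] to [v 0]; as [j] is not [N], both lie outside the arc. *)
  have [eq_p|ne_p] := eqVneq p N; first by rewrite eq_p modnn; lia.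
  by rewrite modn_small; lia.
have closedS : closed (G k) S.
  move=> x y Gxy; have [p le_p [] [ex ey]] := cyc _ _ _ Gxy.
  - rewrite ex ey; apply: arc => // eq_p.
      by move: ni; rewrite -eq_p -ex -ey Gxy.
    by move: nj; rewrite -eq_p -ex -ey Gxy.
  - rewrite ex ey; symmetry; apply: arc => // eq_p.
      by move: ni; rewrite -eq_p -ex -ey adj_sym Gxy.
    by move: nj; rewrite -eq_p -ex -ey adj_sym Gxy.
have := closed_connect closedS (conn k (v j) (v i)).
by rewrite !inS // ltnn leqnn lt_ij.
Qed.

End Travel.

(** * Numbering the cycle from s, and conclusion *)

Lemma cycle_param (V : finType) (g : sgraph V) (s : V) : is_cycle_graph g ->
  exists v : nat -> V, [/\ v 0 = s,
    forall w, exists2 i, i <= #|V|.-1 & v i = w,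
    forall i j, i <= #|V|.-1 -> j <= #|V|.-1 -> v i = v j -> i = j
  & forall x y, g x y -> exists2 i, i <= #|V|.-1 &
      x = v i /\ y = v (i.+1 %% #|V|.-1.+1) \/
      y = v i /\ x = v (i.+1 %% #|V|.-1.+1)].
Proof.
case=> V_gt2 [c [Uc inc adjc]].
have size_c : size c = #|V|.-1.+1.
  rewrite prednK; last by apply: leq_trans V_gt2.
  by rewrite -(card_uniqP Uc); apply: eq_card => x; rewrite !inE inc.
have [k c' rot_c] := rot_to (inc s).
pose d := rot k c; have Ud : uniq d by rewrite rot_uniq.
have ind x : x \in d by rewrite mem_rot.
have size_d : size d = #|V|.-1.+1 by rewrite size_rot.
have nextE i : i <= #|V|.-1 ->
    next c (nth s d i) = nth s d (i.+1 %% #|V|.-1.+1).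
  move=> le_i; rewrite -(next_rot k Uc) -/d next_nth ind.
  move: Ud size_d; rewrite /d rot_c => Ud [size_c'].
  rewrite index_uniq //=; last by rewrite size_c' ltnS.
  move: le_i; rewrite leq_eqVlt => /predU1P[->|lt_i].
    (* Past the last vertex, [nth] returns its default [s], which is the head of [d]. *)
    by rewrite modnn nth_default // size_c'.
  by rewrite modn_small //=; apply: set_nth_default; rewrite size_c'.
exists (nth s d); split.
- by rewrite /d rot_c.
- move=> w; exists (index w d); rewrite ?nth_index //.
  by rewrite -ltnS -size_d index_mem.
- by move=> i j le_i le_j /eqP; rewrite nth_uniq ?size_d // => /eqP.
move=> x y; rewrite adjc => /orP[] /eqP->.
  exists (index x d); first by rewrite -ltnS -size_d index_mem.
  by left; rewrite -nextE ?nth_index // -ltnS -size_d index_mem.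
exists (index y d); first by rewrite -ltnS -size_d index_mem.
by right; rewrite -nextE ?nth_index // -ltnS -size_d index_mem.
Qed.

Theorem lemma16 (V : finType) (L : nat) (C : tgraph V L) (s : V)
    (hC : temporal_cycle C) (hL : 2 * #|V| - 2 <= L) :
  exists j : seq (tstep V L),
    exploration C s j /\ size j <= (3 * (#|V| - 1)) %/ 2.
Proof.
case: hC => conn cyc; have [v [<- surj inj adjE]] := cycle_param s cyc.
have V_gt2 : 2 < #|V| by case: cyc.
rewrite subn1; move: surj inj adjE; set N := #|V|.-1 => surj inj adjE.
have N_gt0 : 0 < N by rewrite /N; lia.
pose pres t i := at_time C t (v i) (v (i.+1 %% N.+1)).
have one : one_missing N pres.
  apply: one_missing_cycle => //; first by rewrite /N; lia.
  by move=> t x y Cxy; apply: adjE; apply/existsP; exists t.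
case: (cheap_tour_or_mirror one); first exact: exploration_of_cheap_tour.
(* Reflected numbering with the same start: its edge [i] is edge [N - i] of [v], reversed. *)
pose v' i := v ((N.+1 - i) %% N.+1).
have -> : v 0 = v' 0 by rewrite /v' subn0 modnn.
apply: exploration_of_cheap_tour => // [t i le_i|w].
  rewrite /mirror /pres /at_time; case: insub => // t'; rewrite adj_sym.
  rewrite /v' -subSn //.
  suff -> : (N.+1 - i.+1 %% N.+1) %% N.+1 = N - i by [].
  move: le_i; rewrite leq_eqVlt => /predU1P[->|lt_i].
    by rewrite modnn subn0 modnn subnn.
  by rewrite [i.+1 %% _]modn_small // subSS modn_small // ltnS leq_subr.
(* The reflection is an involution. *)
have [i le_i <-] := surj w; exists ((N.+1 - i) %% N.+1).
  by rewrite -ltnS ltn_pmod.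
case: i le_i => [|i] le_i; first by rewrite /v' subn0 modnn subn0 modnn.
rewrite /v' subSS [(N - i) %% _]modn_small ?ltnS ?leq_subr //.
by rewrite subSn ?leq_subr // subKn ?modn_small // ltnW.
Qed.
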